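(* Let $f$ be a non-commutative polynomial that is abecedarian with respect to a bucketing system of size $m$, and let $\mathcal{F}$ be a formula of size $s$ computing $f$. If $m=O(\log s)$, then there is an abecedarian formula $\mathcal{F}'$ (with respect to the same bucketing system) computing $f$ of size $\mathrm{poly}(s)$.
   Context: All polynomials are non-commutative: variables do not commute, monomials are words. Formulas are non-commutative formulas (trees with leaves labelled by variables or field constants and internal $+$ and $\times$ gates, where products are taken in a fixed left-to-right order of children). A bucketing system of size $m$ for a set of variables is an ordered tuple $(X_1,\dots,X_m)$ of sets partitioning it. A polynomial $f$ is abecedarian with respect to $(X_1,\dots,X_m)$ if every monomial $y_1\cdots y_k$ ($k\ge1$) with nonzero coefficient satisfies $y_j\in X_{i_j}$ with $i_1\le\cdots\le i_k$. For a polynomial $g$ and $1\le a\le b\le m+1$, $g[a,b)$ is the constant term of $g$ if $a=b$, and if $a<b$ the sum of all terms $c\,y_1\cdots y_k$ ($k\ge1$) of $g$ with $y_j\in X_{i_j}$ and $a=i_1\le\cdots\le i_k<b$. An abecedarian formula (with respect to $(X_1,\dots,X_m)$) computing $f$ is a collection of formulas $\mathcal{F}_1,\dots,\mathcal{F}_m$ such that for each $i\in[m]$: $\mathcal{F}_i$ computes $f[i,m+1)$; each gate $v$ of $\mathcal{F}_i$ carries a label $I_v=[a,b)$ with $1\le a\le b\le m+1$, the root carrying $[i,m+1)$; the polynomial $f_v$ computed at $v$ satisfies $f_v=f_v[a,b)$; if $v$ is a sum gate, its children carry the same label as $v$; if $v=v_1\times v_2$ with $I_v=[a,a)$ then $I_{v_1}=I_{v_2}=[a,a)$;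 if $v=v_1\times v_2$ with $I_v=[a,b)$, $a<b$, then $(I_{v_1},I_{v_2})$ is $([a,b),[b,b))$, or $([a,a),[a,b))$, or $([a,c+1),[c,b))$ for some $a\le c<b$. It computes the sum of the polynomials computed by the $\mathcal{F}_i$; its size is their total size.
   Formalization: The components compute the slices f[i,m+1), which never contain the constant term of f, so their sum is shown to be f minus its constant term (f itself when that term is 0); for f with nonzero constant term no abecedarian formula as defined can sum to f. *)

(* Defs.v *)
From Stdlib Require List.
From HB Require Import structures.
From mathcomp Require Import all_boot all_order all_algebra.
From mathcomp Require Export finmap.
From mathcomp Require Export monalg.

Set Implicit Arguments.
Unset Strict Implicit.
Unset Printing Implicit Defensive.

Import GRing.Theory.
Local Open Scope ring_scope.

(* Non-commutative polynomials over K in the variables X are the elements of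
   the monoid algebra of the free monoid {fmonom X}. *)
Notation ncpoly K X := {malg K[{fmonom X}]}.

(* Gates have arbitrary positive fan-in: the first child is kept apart from
   the list of the others. *)
Inductive formula (K X : Type) : Type :=
| FVar of X
| FConst of K
| FSum of formula K X & seq (formula K X)
| FProd of formula K X & seq (formula K X).

Arguments FVar {K X}.
Arguments FConst {K X}.

Fixpoint fpoly (K : fieldType) (X : choiceType) (v : formula K X) :
    ncpoly K X :=
  match v with
  | FVar x => << fmu x >>
  | FConst c => c%:MP
  | FSum v1 vs => fpoly v1 + \sum_(p <- map (@fpoly K X) vs) p
  | FProd v1 vs => fpoly v1 * \prod_(p <- map (@fpoly K X) vs) p
  end.

(* The number of gates, leaves included. *)
Fixpoint fsize (K X : Type) (v : formula K X) : nat :=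
  match v with
  | FVar _ | FConst _ => 1
  | FSum v1 vs | FProd v1 vs => (fsize v1 + sumn (map (@fsize K X) vs)).+1
  end.

Section Abecedarian.
Variables (K : fieldType) (X : choiceType) (m : nat).

(* A bucketing system of size m is given by the map sending each variable to
   the index of its bucket; the buckets are the fibres, numbered from 0 to
   m - 1, so that labels [a, b) satisfy 0 <= a <= b <= m (a shift by one from
   the numbering from 1 to m, with labels 1 <= a <= b <= m + 1). *)
Variable bk : X -> 'I_m.

Implicit Types (f g : ncpoly K X) (v : formula K X) (a b c : nat).

Definition bucket_word (w : {fmonom X}) : seq nat :=
  [seq nat_of_ord (bk x) | x <- (w : seq X)].

Definition abecedarian f : Prop :=
  forall w : {fmonom X}, w \in msupp f -> sorted leq (bucket_word w).

Definition word_in a b (w : {fmonom X}) : bool :=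
  if bucket_word w is i :: s then
    [&& i == a, path leq i s & last i s < b]%N
  else false.

Definition slice a b g : ncpoly K X :=
  if a == b then (g@_(@mone {fmonom X}))%:MP
  else \sum_(w <- msupp g | word_in a b w) << g@_w *g w >>.

Definition label_ok a b v : Prop :=
  (a <= b <= m)%N /\ fpoly v = slice a b (fpoly v).

(* prod_rule [a, b) [a1, b1) [a2, b2) : a product gate labelled [a, b) may
   have children labelled [a1, b1) and [a2, b2). *)
Inductive prod_rule a b : nat -> nat -> nat -> nat -> Prop :=
| PRconst : a = b -> prod_rule a b a a a a
| PRleft : (a < b)%N -> prod_rule a b a b b b
| PRright : (a < b)%N -> prod_rule a b a a a b
| PRsplit c : (a <= c < b)%N -> prod_rule a b a c.+1 c b.

(* labelled a b v : the gates of v can be labelled as required, the root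
   carrying [a, b); a derivation is exactly a choice of labels for all gates.
   There is no rule for product gates whose fan-in is not 2. *)
Inductive labelled : nat -> nat -> formula K X -> Prop :=
| LVar a b x : label_ok a b (FVar x) -> labelled a b (FVar x)
| LConst a b k : label_ok a b (FConst k) -> labelled a b (FConst k)
| LSum a b v vs :
    label_ok a b (FSum v vs) ->
    (forall u, List.In u (v :: vs) -> labelled a b u) ->
    labelled a b (FSum v vs)
| LProd a b a1 b1 a2 b2 v1 v2 :
    label_ok a b (FProd v1 [:: v2]) ->
    prod_rule a b a1 b1 a2 b2 ->
    labelled a1 b1 v1 -> labelled a2 b2 v2 ->
    labelled a b (FProd v1 [:: v2]).

Definition abc_formula_for f (F : 'I_m -> formula K X) : Prop :=
  forall i : 'I_m, labelled i m (F i) /\ fpoly (F i) = slice i m f.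

Definition abc_poly (F : 'I_m -> formula K X) : ncpoly K X :=
  \sum_(i < m) fpoly (F i).

Definition abc_size (F : 'I_m -> formula K X) : nat :=
  (\sum_(i < m) fsize (F i))%N.

End Abecedarian.

(* Main.v *)
(* Brent's depth reduction applies to non-commutative formulas once the context
   of a subformula u is written l * u * r + o, with multipliers on both sides,
   so f has a formula of depth 4 k as soon as its size is at most 2 ^ k.  On
   such a formula, replace each gate computing p by copies computing the slices
   p[a, b), using
     (p q)[a, b) = p[a, b) q_1 + p_1 q[a, b)
                   + sum over a <= c < b of p[a, c + 1) q[c, b),
   where p_1 and q_1 are the constant terms.  The pieces [a, c + 1) and [c, b)
   of [a, b) have lengths running over 1, ..., b - a, and the sum of 2 ^ j over
   these lengths j is less than 2 * 2 ^ (b - a); hence a slice of a depth d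
   polynomial costs at most 16 ^ d * 2 ^ (b - a), which is polynomial when both
   d and m are logarithmic. *)
Require Import Defs.
From mathcomp Require Import all_boot all_order all_algebra zify.
Import GRing.Theory.
Local Open Scope ring_scope.

Set Implicit Arguments.
Unset Strict Implicit.
Unset Printing Implicit Defensive.

(** * Slices of sums and products *)

Section Slices.
Variables (K : fieldType) (X : choiceType) (m : nat) (bk : X -> 'I_m).
Implicit Types (p q g : ncpoly K X) (w : {fmonom X}).

Lemma word_in1 a b : word_in bk a b (@mone {fmonom X}) = false.
Proof. by rewrite /word_in /bucket_word fm1. Qed.

Lemma mcoeff_slice a b p w : (a < b)%N ->
  (slice bk a b p)@_w = p@_w *+ word_in bk a b w.
Proof.
move=> ltab; rewrite /slice ltn_eqF // raddf_sum /=.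
have [wp|wNp] := boolP (w \in msupp p); last first.
  rewrite (mcoeff_outdom wNp) mul0rn big_seq_cond big1 // => u /andP[up _].
  by rewrite mcoeffU; case: eqP wNp => // <-; rewrite up.
rewrite big_mkcond (bigD1_seq w) ?fset_uniq //= big1 ?addr0 => [|u /negbTE uw].
  by case: (word_in _ _ _ w); rewrite ?mcoeffUU.
by case: ifP => // _; rewrite mcoeffU uw.
Qed.

Lemma sliceD a b p q : (a < b)%N ->
  slice bk a b (p + q) = slice bk a b p + slice bk a b q.
Proof.
move=> ab; apply/malgP => w; rewrite [RHS]mcoeffD [LHS](mcoeff_slice _ _ ab).
rewrite [in LHS]mcoeffD [X in _ = X + _](mcoeff_slice _ _ ab).
by rewrite [X in _ = _ + X](mcoeff_slice _ _ ab) mulrnDl.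
Qed.

Lemma slice0 a b : slice bk a b (0 : ncpoly K X) = 0.
Proof. by rewrite /slice; case: eqP => _; rewrite ?mcoeff0 ?malgC0E // msupp0 big_nil. Qed.

Lemma slice_id a b p : slice bk a b (slice bk a b p) = slice bk a b p.
Proof.
have [->|neq] := eqVneq a b; first by rewrite /slice eqxx malgCK.
have [ab|ba] := ltnP a b.
  apply/malgP => w; rewrite [LHS](mcoeff_slice _ _ ab) [RHS](mcoeff_slice _ _ ab).
    by rewrite [X in X *+ _](mcoeff_slice _ _ ab) -mulrnA mulnb andbb.
(* If [b < a], no word qualifies: a nondecreasing word starting in bucket [a] ends at [a] or
   later. *)
have word_inF w : word_in bk a b w = false.
  rewrite /word_in; case: bucket_word => // i s; apply/negP => /and3P[/eqP-> pis].
  have /allP/(_ (last a s)) : all (leq a) (a :: s).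
    by rewrite /= leqnn; apply: order_path_min => //; apply: leq_trans.
  by rewrite mem_last => /(_ isT); lia.
rewrite [LHS]/slice [RHS]/slice (negbTE neq).
by rewrite !big1 // => w; rewrite word_inF.
Qed.

Lemma slice_monom a b c w : (a < b)%N ->
  slice bk a b << c *g w >> = << c *g w >> *+ word_in bk a b w :> ncpoly K X.
Proof.
move=> ab; apply/malgP => u; rewrite mcoeff_slice // mcoeffMn mcoeffU.
by case: eqP => [->|_] //; rewrite !mul0rn.
Qed.

Lemma slice_const a b c : (a < b)%N -> slice bk a b c%:MP = 0 :> ncpoly K X.
Proof. by move=> ab; rewrite slice_monom // word_in1. Qed.

Lemma const_slice a b p : (a < b)%N -> (slice bk a b p)@_(@mone {fmonom X}) = 0.
Proof. by move=> ab; rewrite mcoeff_slice // word_in1. Qed.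

Lemma last_path_leq i s : path leq i s -> (i <= last i s)%N.
Proof.
elim: s i => //= j s IHs i /andP[ij /IHs]; exact: leq_trans.
Qed.

(** The left end of a nonempty interval is the bucket of the first letter, so two slices with
    different left ends share no word. *)
Lemma slice_slice_neq a b a' b' p : (a < b)%N -> (a' < b')%N -> a != a' ->
  slice bk a b (slice bk a' b' p) = 0.
Proof.
move=> ab ab' neq; apply/malgP => w; rewrite !mcoeff_slice // mcoeff0 -mulrnA.
rewrite /word_in; case: bucket_word => [|i s]; rewrite ?muln0 //.
by have [->|_] := eqVneq i a'; rewrite ?mul0n ?muln0 // eq_sym (negbTE neq) muln0.
Qed.

(** If neither word is empty, only the bucket [c] of the first letter of [w2] can contribute. The
    concatenation is nondecreasing at the seam when [w1] ends at [c] or before, hence the bound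
    [c.+1]. The first two terms cover an empty factor. At most one term is nonzero, so the count is
    exact. *)
Lemma word_inM a b w1 w2 : (a < b)%N ->
  (word_in bk a b (mmul w1 w2) : nat) =
  (word_in bk a b w1 * (w2 == mone) + (w1 == mone) * word_in bk a b w2 +
   \sum_(a <= c < b) word_in bk a c.+1 w1 * word_in bk c b w2)%N.
Proof.
move=> ab; rewrite !fmP /word_in /bucket_word fmM fm1 map_cat.
case: (w1 : seq X) => [|x s] /=.
  by rewrite mul0n mul1n big1 ?addn0 ?add0n.
case: (w2 : seq X) => [|y t] /=.
  by rewrite cats0 muln1 mul0n addn0 big1 ?addn0 // => c _; rewrite muln0.
rewrite muln0 mul0n !add0n cat_path last_cat /=.
move: (nat_of_ord (bk x)) (nat_of_ord (bk y)) => i j.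
move: [seq nat_of_ord (bk z) | z <- s] [seq nat_of_ord (bk z) | z <- t]
  => {x y s t} s t.
have [/andP[aj jb]|] := boolP (a <= j < b)%N; last first.
  move=> abj; rewrite big1_seq => [|c]; last first.
    rewrite mem_index_iota => /= acb.
    by have [ejc|] := eqVneq j c; [rewrite ejc acb in abj | rewrite muln0].
  apply/eqP; rewrite eqb0; apply: contra abj => /and3P[/eqP <-].
  case/and3P => /last_path_leq ? ? /last_path_leq ? ?; lia.
rewrite (bigD1_seq j) ?iota_uniq ?mem_index_iota ?aj //= big1 => [|c]; last first.
  by rewrite eq_sym => /negbTE->; rewrite muln0.
by rewrite addn0 eqxx mulnb ltnS -!andbA.
Qed.

Lemma malg_ind (P : ncpoly K X -> Prop) :
  P 0 -> (forall p q, P p -> P q -> P (p + q)) ->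
  (forall c w, P << c *g w >>) -> forall p, P p.
Proof.
by move=> P0 PD PU p; rewrite (monalgE p); apply: big_ind.
Qed.

Lemma const_monom c w :
  (<< c *g w >>@_(@mone {fmonom X}))%:MP = << c *g w >> *+ (w == mone) :> ncpoly K X.
Proof.
rewrite mcoeffU; case: eqP => [->|_] //; exact: malgC0E.
Qed.

Lemma monomM c1 c2 w1 w2 :
  << c1 *g w1 >> * << c2 *g w2 >> = << c1 * c2 *g mmul w1 w2 >> :> ncpoly K X.
Proof. exact: fgmulUU. Qed.

(** Both sides are additive in [p] and in [q], which leaves two monomials, where [word_inM] compares
    the multiplicities. *)
Lemma sliceM a b p q : (a < b)%N ->
  slice bk a b (p * q) =
    slice bk a b p * (q@_(@mone {fmonom X}))%:MP +
    (p@_(@mone {fmonom X}))%:MP * slice bk a b q +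
    \sum_(a <= c < b) slice bk a c.+1 p * slice bk c b q.
Proof.
move=> ab; elim/malg_ind: p q => [q|p1 p2 IH1 IH2 q|c1 w1 q].
- rewrite mul0r !slice0 mcoeff0 malgC0E !mul0r !add0r big1 // => c _.
  by rewrite slice0 mul0r.
- rewrite [in LHS]mulrDl [LHS](sliceD _ _ ab) [X in X + _ = _]IH1 [X in _ + X = _]IH2.
  rewrite [in RHS](sliceD _ _ ab) [in RHS]mcoeffD [in RHS]monalgUD.
  rewrite [X in _ = X + _ + _]mulrDl [X in _ = _ + X + _]mulrDl.
  rewrite [X in _ = _ + X](eq_big_nat _ _ (F2 := fun c =>
    slice bk a c.+1 p1 * slice bk c b q + slice bk a c.+1 p2 * slice bk c b q)).
    by rewrite big_split addrACA [X in X + _ = _]addrACA.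
  by move=> c /andP[ac _]; rewrite sliceD ?ltnS // mulrDl.
elim/malg_ind: q => [|q1 q2 IH1 IH2|c2 w2].
- rewrite [in RHS]mcoeff0 malgC0E !mulr0 !slice0 !mulr0 !add0r big1 // => c _.
  by rewrite slice0 mulr0.
- rewrite [in LHS]mulrDr [LHS](sliceD _ _ ab) [X in X + _ = _]IH1 [X in _ + X = _]IH2.
  rewrite [in RHS](sliceD _ _ ab) [in RHS]mcoeffD [in RHS]monalgUD.
  rewrite [X in _ = X + _ + _]mulrDr [X in _ = _ + X + _]mulrDr.
  set p1 := << c1 *g w1 >>.
  rewrite [X in _ = _ + X](eq_big_nat _ _ (F2 := fun c =>
    slice bk a c.+1 p1 * slice bk c b q1 + slice bk a c.+1 p1 * slice bk c b q2)).
    by rewrite big_split addrACA [X in X + _ = _]addrACA.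
  by move=> c /andP[_ cb]; rewrite sliceD // mulrDr.
rewrite monomM.
rewrite !const_monom [LHS](slice_monom _ _ ab) (slice_monom c1 w1 ab)
  (slice_monom c2 w2 ab) (word_inM _ _ ab).
rewrite [X in _ = _ + X](eq_big_nat _ _ (F2 := fun c => << c1 * c2 *g mmul w1 w2 >>
  *+ (word_in bk a c.+1 w1 * word_in bk c b w2))); last first.
  by move=> c /andP[ac cb]; rewrite !slice_monom ?ltnS // mulrnAl
    mulrnAr -mulrnA mulnC monomM.
rewrite [LHS]mulrnDr [X in X + _ = _]mulrnDr -sumrMnr !mulrnAl !mulrnAr -!mulrnA.
by rewrite !monomM [(_ * (w1 == _))%N]mulnC mulnC.
Qed.

(** Together with the next two lemmas, this provides [label_ok] for the product gates built later.
    In each case a single term of [sliceM] survives. *)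
Lemma slice_mul_const a b p c : (a < b)%N ->
  slice bk a b (slice bk a b p * c%:MP) = slice bk a b p * c%:MP.
Proof.
move=> ab; rewrite [LHS](sliceM _ _ ab) (const_slice _ ab) malgC0E mul0r addr0.
rewrite (malgCK c) slice_id big_nat big1 ?addr0 // => d /andP[_ db].
by rewrite (slice_const c db) mulr0.
Qed.

Lemma slice_const_mul a b p c : (a < b)%N ->
  slice bk a b (c%:MP * slice bk a b p) = c%:MP * slice bk a b p.
Proof.
move=> ab; rewrite [LHS](sliceM _ _ ab) (const_slice _ ab) malgC0E mulr0 add0r.
rewrite (malgCK c) slice_id big_nat big1 ?addr0 // => d /andP[ad _].
by rewrite (slice_const c (ad : (a < d.+1)%N)) mul0r.
Qed.

Lemma slice_mul_slice a c b p q : (a <= c < b)%N ->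
  slice bk a b (slice bk a c.+1 p * slice bk c b q) = slice bk a c.+1 p * slice bk c b q.
Proof.
move=> acb; have [ac cb] := andP acb.
rewrite [LHS](sliceM _ _ (leq_ltn_trans ac cb)).
have eP := slice_id a c.+1 p; have eQ := slice_id c b q.
have cP := const_slice p (ac : (a < c.+1)%N); have cQ := const_slice q cb.
rewrite cQ cP malgC0E [X in X + _ + _]mulr0 [X in _ + X + _]mul0r.
rewrite [X in X + _]addr0 [LHS]add0r.
have cab : c \in index_iota a b by rewrite mem_index_iota.
(* The cuts [d != c] vanish because the right factor has only words starting in bucket [c]. *)
rewrite (bigD1_seq c cab (iota_uniq _ _)) big1_seq => [|d].
  by rewrite /= eP eQ addr0.
case/andP=> dc; rewrite mem_index_iota => /andP[_ db].
by rewrite (slice_slice_neq _ db cb dc) mulr0.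
Qed.

End Slices.

(** * Brent's depth reduction *)

Section DepthReduction.
Variables (K : fieldType) (X : choiceType).
Implicit Types p q : ncpoly K X.

(** [s] bounds the number of leaves of a formula with gates of fan-in 2. Gates are not counted, so
    the bounds of the operands simply add. *)
Inductive sized : nat -> ncpoly K X -> Prop :=
| SizedVar s x : (0 < s)%N -> sized s << fmu x >>
| SizedConst s c : (0 < s)%N -> sized s c%:MP
| SizedAdd s s1 s2 p q :
    sized s1 p -> sized s2 q -> (s1 + s2 <= s)%N -> sized s (p + q)
| SizedMul s s1 s2 p q :
    sized s1 p -> sized s2 q -> (s1 + s2 <= s)%N -> sized s (p * q).

Inductive depth : nat -> ncpoly K X -> Prop :=
| DepthVar d x : depth d << fmu x >>
| DepthConst d c : depth d c%:MP
| DepthAdd d p q : depth d p -> depth d q -> depth d.+1 (p + q)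
| DepthMul d p q : depth d p -> depth d q -> depth d.+1 (p * q).

Lemma sized_gt0 s p : sized s p -> (0 < s)%N.
Proof. by elim=> // {}s s1 s2 {}p q _ ? _ ? ?; lia. Qed.

Lemma sized_mono s s' p : (s <= s')%N -> sized s p -> sized s' p.
Proof.
move=> le sp; case: sp le => {p}s0 => [x ?|c ?|s1 s2 p q H1 H2 ?|s1 s2 p q H1 H2 ?] le.
- by apply: SizedVar; lia.
- by apply: SizedConst; lia.
- by apply: SizedAdd H1 H2 _; lia.
- by apply: SizedMul H1 H2 _; lia.
Qed.

Lemma depth_mono d d' p : (d <= d')%N -> depth d p -> depth d' p.
Proof.
move=> le dp; elim: dp d' le => {d p}.
- by move=> d x d' _; apply: DepthVar.
- by move=> d c d' _; apply: DepthConst.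
- by move=> d p q _ IHp _ IHq [|d'] // le; apply: DepthAdd; auto.
- by move=> d p q _ IHp _ IHq [|d'] // le; apply: DepthMul; auto.
Qed.

(** A gate of large fan-in unfolds into a left comb of binary gates, which adds no leaves. *)
Lemma sized_fpoly (F : formula K X) : sized (fsize F) (fpoly F).
Proof.
have fold_add s p vs : sized s p ->
    (forall v, List.In v vs -> sized (fsize v) (fpoly v)) ->
    sized (s + sumn (map (@fsize K X) vs)) (p + \sum_(r <- map (@fpoly K X) vs) r).
  elim: vs s p => [|v vs IHvs] s p sp svs /=; first by rewrite big_nil addr0 addn0.
  rewrite big_cons addrA addnA; apply: IHvs => [|u uvs]; last by apply: svs; right.
  by apply: SizedAdd sp (svs v _) _ => //; left.
have fold_mul s p vs : sized s p ->
    (forall v, List.In v vs -> sized (fsize v) (fpoly v)) ->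
    sized (s + sumn (map (@fsize K X) vs)) (p * \prod_(r <- map (@fpoly K X) vs) r).
  elim: vs s p => [|v vs IHvs] s p sp svs /=; first by rewrite big_nil mulr1 addn0.
  rewrite big_cons mulrA addnA; apply: IHvs => [|u uvs]; last by apply: svs; right.
  by apply: SizedMul sp (svs v _) _ => //; left.
move: F; fix IH 1 => -[x|c|v vs|v vs].
- exact: SizedVar.
- exact: SizedConst.
- apply: (sized_mono (leqnSn _)); apply: fold_add (IH v) _.
  by move: vs; fix IHvs 1 => -[w []|u vs w [<-|]]; [exact: IH|exact: IHvs].
- apply: (sized_mono (leqnSn _)); apply: fold_mul (IH v) _.
  by move: vs; fix IHvs 1 => -[w []|u vs w [<-|]]; [exact: IH|exact: IHvs].
Qed.

(* Follow the operand of size more than t until both operands have size at most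
   t.  As sized is monotone in s, a leaf x may also come with s > t; it then
   counts as the gate x + 0. *)
Lemma sized_split t s p : (0 < t < s)%N -> sized s p ->
  exists s' l r o u, [/\ (t < s' <= s)%N,
    [/\ sized (s - s').+1 l, sized (s - s').+1 r & sized (s - s').+1 o],
    exists q1 q2, [/\ sized t q1, sized t q2 & u = q1 + q2 \/ u = q1 * q2]
    & p = l * u * r + o].
Proof.
case/andP=> t_gt0 ts sp.
have here s0 u : (t < s0)%N ->
    (exists q1 q2, [/\ sized t q1, sized t q2 & u = q1 + q2 \/ u = q1 * q2]) ->
  exists s' l r o u', [/\ (t < s' <= s0)%N,
    [/\ sized (s0 - s').+1 l, sized (s0 - s').+1 r & sized (s0 - s').+1 o],
    exists q1 q2, [/\ sized t q1, sized t q2 & u' = q1 + q2 \/ u' = q1 * q2]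
    & u = l * u' * r + o].
  (* The empty context [1 * u * 1 + 0] consists of constants of size 1, hence the successor in the
     bound [(s - s').+1]. *)
  move=> lt Hu; exists s0, 1%:MP, 1%:MP, 0%:MP, u; split=> //; first lia.
    by split; apply: SizedConst.
  by rewrite mpolyC1E malgC0E mul1r mulr1 addr0.
elim: sp ts => {s p}.
- move=> s x _ ts; apply: here => //; exists << fmu x >>, 0%:MP.
  by split; [apply: SizedVar|apply: SizedConst|left; rewrite malgC0E addr0].
- move=> s c _ ts; apply: here => //; exists c%:MP, 0%:MP.
  by split; [apply: SizedConst|apply: SizedConst|left; rewrite malgC0E addr0].
- move=> s s1 s2 p q sp IHp sq IHq le ts.
  have s1_gt0 := sized_gt0 sp; have s2_gt0 := sized_gt0 sq.
  have [ts1|s1t] := ltnP t s1.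
    have [s' [l [r [o [u [ts' [sl sr so] Hu ->]]]]]] := IHp ts1.
    exists s', l, r, (o + q), u; split=> //; [lia|split|by rewrite addrA].
    - by apply: sized_mono sl; lia.
    - by apply: sized_mono sr; lia.
    - by apply: SizedAdd so sq _; lia.
  have [ts2|s2t] := ltnP t s2.
    have [s' [l [r [o [u [ts' [sl sr so] Hu ->]]]]]] := IHq ts2.
    exists s', l, r, (p + o), u; split=> //; [lia|split|by rewrite addrCA].
    - by apply: sized_mono sl; lia.
    - by apply: sized_mono sr; lia.
    - by apply: SizedAdd sp so _; lia.
  apply: here => //.
  by exists p, q; split; [apply: sized_mono sp|apply: sized_mono sq|left].
- move=> s s1 s2 p q sp IHp sq IHq le ts.
  have s1_gt0 := sized_gt0 sp; have s2_gt0 := sized_gt0 sq.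
  have [ts1|s1t] := ltnP t s1.
    have [s' [l [r [o [u [ts' [sl sr so] Hu ->]]]]]] := IHp ts1.
    (* The factor [q] is copied into both [r] and [o]; this is harmless because the context parts
       are bounded separately. *)
    exists s', l, (r * q), (o * q), u; split=> //;
      [lia|split|by rewrite [LHS]mulrDl -[in LHS]mulrA].
    - by apply: sized_mono sl; lia.
    - by apply: SizedMul sr sq _; lia.
    - by apply: SizedMul so sq _; lia.
  have [ts2|s2t] := ltnP t s2.
    have [s' [l [r [o [u [ts' [sl sr so] Hu ->]]]]]] := IHq ts2.
    exists s', (p * l), r, (p * o), u; split=> //;
      [lia|split|by rewrite [LHS]mulrDr 2!mulrA].
    - by apply: SizedMul sp sl _; lia.
    - by apply: sized_mono sr; lia.
    - by apply: SizedMul sp so _; lia.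
  apply: here => //.
  by exists p, q; split; [apply: sized_mono sp|apply: sized_mono sq|right].
Qed.

(** Splitting at [s./2] leaves the operands of [u] and the parts [l], [r], [o] with size at most
    [s - s./2]. Rebuilding [l * u * r + o] costs four levels: the gate of [u], two products and one
    sum. *)
Lemma sized_depth k s p : (s <= 2 ^ k)%N -> sized s p -> depth (4 * k) p.
Proof.
elim: k s p => [|k IHk] s p les sp.
  rewrite expn0 in les; case: sp les => {s p}.
  - by move=> s x _ _; apply: DepthVar.
  - by move=> s c _ _; apply: DepthConst.
  - by move=> s s1 s2 p q /sized_gt0 ? /sized_gt0 ? ? ?; lia.
  - by move=> s s1 s2 p q /sized_gt0 ? /sized_gt0 ? ? ?; lia.
rewrite expnS in les.
have [s1|s1] := leqP s 1.
  apply: (@depth_mono (4 * k)); first lia.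
  by apply: IHk sp; rewrite (leq_trans s1) // expn_gt0.
have [|s' [l [r [o [u [s's [sl sr so] [q1 [q2 [sq1 sq2 Hu]]] ->]]]]]] :=
  sized_split (t := s./2) _ sp.
  by lia.
have dep t q : (t <= s - s./2)%N -> sized t q -> depth (4 * k) q.
  by move=> tq; apply: IHk; lia.
rewrite mulnS addnC addn4; apply: DepthAdd; last first.
  by apply: (@depth_mono (4 * k)); [lia|apply: dep so; lia].
apply: DepthMul; last by apply: (@depth_mono (4 * k)); [lia|apply: dep sr; lia].
apply: DepthMul; first by apply: (@depth_mono (4 * k)); [lia|apply: dep sl; lia].
by case: Hu => ->; [apply: DepthAdd|apply: DepthMul];
  solve [apply: dep sq1; lia | apply: dep sq2; lia].
Qed.

End DepthReduction.

(** * Abecedarian formulas for slices *)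

Section Abecedarian.
Variables (K : fieldType) (X : choiceType) (m : nat) (bk : X -> 'I_m).
Implicit Types (p q g : ncpoly K X) (w : {fmonom X}).

Lemma label_ok_fixed a b v p : (a <= b <= m)%N ->
  fpoly v = p -> slice bk a b p = p -> label_ok bk a b v.
Proof. by move=> abm ev e; split; [exact: abm|rewrite ev e]. Qed.

(* Unqualified, FProd is the constructor of finfun's fprod. *)
Lemma fpoly_prod v u : fpoly (Defs.FProd v [:: u] : formula K X) = fpoly v * fpoly u.
Proof. by rewrite /= big_seq1. Qed.

Lemma fpoly_sum v u (vs : seq (formula K X)) :
  fpoly (FSum v (u :: vs)) = fpoly v + (fpoly u + \sum_(r <- map (@fpoly K X) vs) r).
Proof. by rewrite /= big_cons. Qed.

Lemma labelled_const a b c : (a <= b <= m)%N ->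
  c%:MP = slice bk a b (c%:MP : ncpoly K X) -> labelled bk a b (FConst c).
Proof. by move=> ab e; apply: LConst; split. Qed.

Lemma labelled_const_diag a c : (a <= m)%N -> labelled bk a a (FConst c : formula K X).
Proof.
move=> am; apply: labelled_const; first by rewrite leqnn.
by rewrite /slice eqxx malgCK.
Qed.

Lemma labelled_seq a b (g : nat -> ncpoly K X) (n : nat -> nat) (s : seq nat) :
  (forall c, c \in s -> exists v,
    [/\ labelled bk a b v, fpoly v = g c & (fsize v <= n c)%N]) ->
  exists vs : seq (formula K X), [/\ forall u, List.In u vs -> labelled bk a b u,
    \sum_(r <- map (@fpoly K X) vs) r = \sum_(c <- s) g c &
    (sumn (map (@fsize K X) vs) <= \sum_(c <- s) n c)%N].
Proof.
elim: s => [|c s IHs] Hs; first by exists [::]; split=> //; rewrite !big_nil.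
have [v [lv pv sv]] := Hs c (mem_head _ _).
have [|vs [lvs pvs svs]] := IHs; first by move=> d ds; apply: Hs; rewrite inE ds orbT.
exists (v :: vs); split=> [u [<- //|/lvs //]| |] /=.
  by rewrite !big_cons pv pvs.
by rewrite big_cons leq_add.
Qed.

Lemma sum_pow2_cuts a b : (a <= b)%N ->
  (\sum_(a <= c < b) (2 ^ (c.+1 - a) + 2 ^ (b - c)) <= 2 * 2 ^ (b - a).+1)%N.
Proof.
have geom n : (\sum_(0 <= k < n) 2 ^ k.+1 <= 2 ^ n.+1)%N.
  by elim: n => [|n IHn]; [rewrite big_nil|rewrite big_nat_recr //= (expnS 2 n.+1); lia].
move=> ab; rewrite big_split -{1 3}[a]add0n !big_addn mul2n -addnn /=.
(* The lengths [c.+1 - a] increase with [c] and the lengths [b - c] decrease; reversing the second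
   sum makes both the same geometric sum. *)
apply: leq_add; last rewrite big_nat_rev; apply: leq_trans (geom _);
  rewrite big_nat [X in (_ <= X)%N]big_nat; apply: leq_sum => c cab;
  by rewrite leq_exp2l //; lia.
Qed.

Lemma labelled_slice d p a b : depth d p -> (a < b <= m)%N ->
  exists v : formula K X, [/\ labelled bk a b v, fpoly v = slice bk a b p &
    (fsize v <= 16 ^ d * 2 ^ (b - a))%N].
Proof.
move=> dp; elim: dp a b =>
  {d p} [d x|d c|d p q _ IHp _ IHq|d p q _ IHp _ IHq] a b /andP[ab bm].
- have pos : (1 <= 16 ^ d * 2 ^ (b - a))%N by rewrite muln_gt0 !expn_gt0.
  have [wx|wx] := boolP (word_in bk a b (fmu x)).
    have e : << fmu x >> = slice bk a b (<< fmu x >> : ncpoly K X).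
      by rewrite slice_monom // wx.
    by exists (FVar x); split=> //; apply: LVar; split; rewrite // ltnW.
  (* An empty slice is computed by the constant 0, which may carry any label. *)
  exists (FConst 0); split=> //; last by rewrite slice_monom // (negbTE wx) /= malgC0E.
  by apply: labelled_const; rewrite ?malgC0E ?slice0 // ltnW.
- have pos : (1 <= 16 ^ d * 2 ^ (b - a))%N by rewrite muln_gt0 !expn_gt0.
  exists (FConst 0); split=> //; last by rewrite slice_const //= malgC0E.
  by apply: labelled_const; rewrite ?malgC0E ?slice0 // ltnW.
- have [|v1 [l1 p1 s1]] := IHp a b; first by rewrite ab.
  have [|v2 [l2 p2 s2]] := IHq a b; first by rewrite ab.
  have e : fpoly (FSum v1 [:: v2]) = slice bk a b (p + q).
    by rewrite /= big_seq1 p1 p2 (sliceD bk p q ab).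
  exists (FSum v1 [:: v2]); split=> //.
    apply: LSum; first by apply: label_ok_fixed e (slice_id _ _ _ _); lia.
    by move=> u [<- //|[<- //|]].
  have pos : (1 <= 16 ^ d * 2 ^ (b - a))%N by rewrite muln_gt0 !expn_gt0.
  by rewrite /= addn0 expnS -mulnA; lia.
have [|v1 [l1 p1 s1]] := IHp a b; first by rewrite ab.
have [|v2 [l2 p2 s2]] := IHq a b; first by rewrite ab.
pose cp := p@_(@mone {fmonom X}); pose cq := q@_(@mone {fmonom X}).
pose vl := Defs.FProd v1 [:: FConst cq]; pose vr := Defs.FProd (FConst cp) [:: v2].
have pl : fpoly vl = slice bk a b p * cq%:MP.
  exact: etrans (fpoly_prod _ _) (congr1 (fun r => r * _) p1).
have pr : fpoly vr = cp%:MP * slice bk a b q.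
  exact: etrans (fpoly_prod _ _) (congr1 (fun r => _ * r) p2).
have abm : (a <= b <= m)%N by lia.
have ll : labelled bk a b vl.
  have ok := label_ok_fixed abm pl (slice_mul_const _ _ _ ab).
  by apply: (LProd ok (PRleft ab) l1); apply: labelled_const_diag.
have lr : labelled bk a b vr.
  have ok := label_ok_fixed abm pr (slice_const_mul _ _ _ ab).
  by apply: (LProd ok (PRright ab) _ l2); apply: labelled_const_diag; lia.
pose N k := (16 ^ d * 2 ^ k)%N.
have [|vs [lvs pvs svs]] := @labelled_seq a b (fun c => slice bk a c.+1 p * slice bk c b q)
    (fun c => (N (c.+1 - a) + N (b - c)).+1)%N (index_iota a b).
  move=> c; rewrite mem_index_iota => acb.
  have [|u1 [k1 r1 t1]] := IHp a c.+1; first by lia.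
  have [|u2 [k2 r2 t2]] := IHq c b; first by lia.
  have r : fpoly (Defs.FProd u1 [:: u2]) = slice bk a c.+1 p * slice bk c b q.
    by rewrite -r1 -r2; exact: fpoly_prod.
  exists (Defs.FProd u1 [:: u2]); split; [|exact: r|by rewrite /= addn0 ltnS leq_add].
  have ok := label_ok_fixed abm r (slice_mul_slice _ _ _ acb).
  exact: LProd ok (PRsplit acb) k1 k2.
have e : fpoly (FSum vl (vr :: vs)) = slice bk a b (p * q).
  rewrite [RHS](sliceM bk p q ab) -addrA -pl -pr -pvs; exact: fpoly_sum.
exists (FSum vl (vr :: vs)); split; [|exact: e|].
  apply: LSum; first exact: label_ok_fixed e (slice_id _ _ _ _).
  by move=> u [<- //|[<- //|/lvs //]].
have sumN : (\sum_(a <= c < b) (N (c.+1 - a) + N (b - c)).+1 <=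
    (b - a) + 16 ^ d * (2 * 2 ^ (b - a).+1))%N.
  under eq_bigr => c _ do rewrite -addn1 /N -mulnDr.
  rewrite big_split /= sum_nat_const_nat muln1 addnC leq_add2l -big_distrr.
  exact: leq_mul (leqnn _) (sum_pow2_cuts (ltnW ab)).
have pos : (1 <= 16 ^ d)%N by rewrite expn_gt0.
have ltn2 : (b - a < 2 ^ (b - a))%N by apply: ltn_expl.
(* With [D = 16 ^ d] and [Y = 2 ^ (b - a)], the size is at most
   [5 + 2 * D * Y + (b - a) + 4 * D * Y]: the 5 counts the sum gate and the gates and constants of
   [vl] and [vr]. As [b - a < Y], the bound [16 * D * Y] has room to spare. *)
move: svs s1 s2 sumN pos ltn2; rewrite /= !addn0 addn1 !expnS.
set Y := (2 ^ (b - a))%N; set D := (16 ^ d)%N => svs s1 s2 sumN pos ltn2.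
have YDY : (Y <= D * Y)%N by rewrite leq_pmull.
have e4 : (D * (2 * (2 * Y)) = 4 * (D * Y))%N by rewrite mulnA mulnCA mulnC; lia.
by rewrite -mulnA; lia.
Qed.

(** A nonempty nondecreasing word lies in exactly one slice, the one starting at the bucket of its
    first letter; the empty word lies in none. *)
Lemma sum_slices (f : ncpoly K X) : abecedarian bk f ->
  \sum_(i < m) slice bk i m f = f - (f@_(@mone {fmonom X}))%:MP.
Proof.
move=> abf; apply/malgP => w; rewrite [RHS]mcoeffB mcoeffC raddf_sum /=.
transitivity (\sum_(i < m) f@_w *+ word_in bk i m w).
  by apply: eq_bigr => i _; apply: mcoeff_slice.
have [->|w1] := eqVneq w mone.
  by rewrite subrr big1 // => i _; rewrite word_in1.
rewrite subr0; have [wf|/mcoeff_outdom->] := boolP (w \in msupp f); last first.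
  by rewrite big1 // => i _; rewrite mul0rn.
move: (abf w wf); rewrite /word_in /bucket_word.
case E: (w : seq X) => [|x s] /= ps.
  by rewrite fmP E fm1 in w1.
have lt_last : (last (nat_of_ord (bk x)) [seq nat_of_ord (bk y) | y <- s] < m)%N.
  by rewrite (last_map (fun y => nat_of_ord (bk y))).
rewrite (bigD1 (bk x)) //= eqxx ps lt_last big1 ?addr0 // => i.
by rewrite -val_eqE eq_sym => /negbTE /= ->.
Qed.

End Abecedarian.

(* The constants of m = O(log s) and poly(s) are C and c: whenever
   m <= C * log s, the size obtained is at most c * s ^ c.
   The slices f[i, m) never contain the constant term of f, so the sum of the
   components is f when that term is 0, and f minus its constant term in
   general. *)
Theorem theorem1p2 :
  forall C : nat, exists c : nat,
  forall (K : fieldType) (X : choiceType) (m : nat) (bk : X -> 'I_m)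
         (f : ncpoly K X) (F : formula K X),
    abecedarian bk f ->
    fpoly F = f ->
    (m <= C * trunc_log 2 (fsize F))%N ->
    exists F' : 'I_m -> formula K X,
      [/\ abc_formula_for bk f F',
          abc_poly F' = f - (f@_(@mone {fmonom X}))%:MP
        & (abc_size F' <= c * fsize F ^ c)%N].
Proof.
(* The total is at most [2 ^ 16 * s ^ (16 + 2 * C)]: [16 ^ (4 * k)] is the 16th power of
   [2 ^ k <= 2 * s], and [s ^ C] bounds both [2 ^ (m - i)] and the number [m] of components. *)
move=> C; exists (2 ^ 16 + 16 + 2 * C)%N => K X m bk f F abf Ff leC.
pose s := fsize F; pose k := up_log 2 s.
have s_gt0 : (0 < s)%N by rewrite /s; case: (F).
have df : depth (4 * k) f.
  rewrite -Ff; apply: sized_depth (sized_fpoly F); rewrite -/s /k.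
  exact: up_logP.
have slices (i : 'I_m) : exists v : formula K X, [/\ labelled bk i m v,
    fpoly v = slice bk i m f & (fsize v <= 16 ^ (4 * k) * 2 ^ (m - i))%N].
  by apply: labelled_slice => //; rewrite ltn_ord leqnn.
have [F' HF'] := fin_all_exists slices.
exists F'; split=> [i||]; first by have [] := HF' i.
  by rewrite /abc_poly -(sum_slices abf); apply: eq_bigr => i _; have [] := HF' i.
(* Rounding the logarithm up costs at most a factor 2; [s = 1] is treated apart, since there the
   logarithm is 0. *)
have leS : (2 ^ k <= 2 * s)%N.
  rewrite /k; case: (ltnP 1 s) => [s1|s1].
    have /andP[lt _] := up_log_bounds (isT : (1 < 2)%N) s1.
    have : (0 < up_log 2 s)%N by rewrite up_log_gt0.
    by case: (up_log 2 s) lt => // n /= lt _; rewrite expnS leq_mul2l ltnW.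
  by have -> : s = 1%N by lia.
have le2m : (2 ^ m <= s ^ C)%N.
  apply: leq_trans (_ : 2 ^ (C * trunc_log 2 s) <= _)%N; first by rewrite leq_exp2l.
  by rewrite mulnC expnM; case: (C) => // n; rewrite leq_exp2r //; apply: trunc_logP.
have le16 : (16 ^ (4 * k) <= 2 ^ 16 * s ^ 16)%N.
  rewrite -expnMn (_ : 16 = 2 ^ 4)%N // -expnM mulnA (_ : 4 * 4 = 16)%N // mulnC expnM.
  by rewrite leq_exp2r.
apply: (@leq_trans (\sum_(i < m) 2 ^ 16 * s ^ 16 * s ^ C)%N).
  apply: leq_sum => i _; have [_ _ le] := HF' i; apply: leq_trans le _.
  by apply: leq_mul => //; apply: leq_trans le2m; rewrite leq_exp2l // leq_subr.
rewrite sum_nat_const card_ord.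
have lem : (m <= s ^ C)%N by apply: leq_trans le2m; apply/ltnW/ltn_expl.
apply: (@leq_trans (s ^ C * (2 ^ 16 * s ^ 16 * s ^ C))%N); first by rewrite leq_mul2r lem orbT.
move: (2 ^ 16)%N => A.
rewrite mulnCA -(mulnA A) -!expnD; apply: leq_mul; first by rewrite -addnA leq_addr.
by rewrite leq_pexp2l //; lia.
Qed.
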